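(* Let $A$ be a tabular algebra with table datum $(\Lambda,\Gamma,B,M,C,* )$, and let $(\Lambda',\Gamma',B',M',C',*')$ be a subdatum corresponding to an $\mathcal A$-subalgebra $A'$ of $A$. If $A'$ contains all the idempotents $\{1_\varepsilon:\varepsilon\in\mathcal E\}$ of axiom (A1) (recalled in the context), then the given subdatum is a table datum for $A'$. If, furthermore, $A$ is a tabular algebra with trace, then so is $A'$.
   Context: Let $\mathcal A=\mathbb Z[v,v^{-1}]$, $\mathcal A^-=\mathbb Z[v^{-1}]$. **Hypergroup.** A hypergroup over $\mathbb Z$ is a pair $(\Gamma,B)$ with $\Gamma$ an associative unital $\mathbb Z$-algebra and $B$ a distinguished $\mathbb Z$-basis with $1\in B$ such that: (H1) structure constants with respect to $B$ are nonnegative integers; (H2) there is an algebra anti-automorphism $\bar{\ }$ of $\Gamma$ with square the identity and $\overline B=B$; (H3) if $\kappa(b,a)$ is the coefficient of $b\in B$ in $a$, then $\kappa(b_m,b_ib_j)=\kappa(b_i,b_m\overline{b_j})$ for all $b_i,b_j,b_m\in B$. A homomorphism of based rings $(\Gamma,B)\to(\Gamma',B')$ is a homomorphism of $\mathbb Z$-algebras sending each $b\in B$ into $B'\cup\{0\}$. **Tabular algebra.** A tabular algebra is an $\mathcal A$-algebra $A$ with a table datum $(\Lambda,\Gamma,B,M,C,* )$ where: (A1) $\Lambda$ is a finite poset; for each $\lambda$, $(\Gamma(\lambda),B(\lambda))$ is a hypergroup over $\mathbb Z$ and $M(\lambda)$ is a finite set; $C:\coprod_\lambda(M(\lambda)\times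 B(\lambda)\times M(\lambda))\to A$ is injective with image an $\mathcal A$-basis of $A$; and $\operatorname{Im}(C)$ contains a set of mutually orthogonal idempotents $\{1_\varepsilon:\varepsilon\in\mathcal E\}$ with $A=\sum_{\varepsilon,\varepsilon'}1_\varepsilon A1_{\varepsilon'}$ and such that each $X\in\operatorname{Im}(C)$ satisfies $X=1_\varepsilon X1_{\varepsilon'}$ for some $\varepsilon,\varepsilon'\in\mathcal E$. (A2) Writing $C_{S,T}^b=C(S,b,T)$, $*$ is an $\mathcal A$-linear involutory anti-automorphism of $A$ with $(C_{S,T}^b)^*=C_{T,S}^{\bar b}$. Extend $C_{S,T}^g$ linearly in $g$. (A3) For $\lambda\in\Lambda$, $g\in\Gamma(\lambda)$, $S,T\in M(\lambda)$, $a\in A$: $a\,C_{S,T}^g\equiv\sum_{S'\in M(\lambda)}C_{S',T}^{r_a(S',S)g}\bmod A(<\lambda)$, with $r_a(S',S)\in\mathcal A\otimes_{\mathbb Z}\Gamma(\lambda)$ independent of $T$ and $g$; $A(<\lambda)$ is the $\mathcal A$-span of the images under $C$ of $M(\mu)\times B(\mu)\times M(\mu)$ for $\mu<\lambda$. **Tabular algebra with trace.** For $X,Y\in\operatorname{Im}(C)$ write $XY=\sum_Z g_{X,Y,Z}Z$ (sum over $Z\in\operatorname{Im}(C)$), and put $\mathbf a(Z)=\max_{X,Y\in\operatorname{Im}(C)}\deg(g_{X,Y,Z})$, where the degree of a Laurent polynomial is the highest power of $v$ occurring with nonzero coefficient. Let $\gamma_{X,Y,Z}\in\mathbb Z$ be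 the coefficient of $v^{\mathbf a(Z)}$ in $g_{X,Y,Z}$. A tabular algebra with trace is a tabular algebra also satisfying: (A4) For $K=C_{S,T}^b$, $K'=C_{U,V}^{b'}$, $K''=C_{X,Y}^{b''}$ in $\operatorname{Im}(C)$, $\deg(g_{K,K',K''})=\mathbf a(K'')$ if and only if $X=S$, $T=U$, $Y=V$ and $b''$ occurs with nonzero coefficient in $bb'$; if these hold and $b=b'=b''=1$ then $\gamma_{K,K',K''}=1$. (A5) There is an $\mathcal A$-linear $\tau:A\to\mathcal A$ with $\tau(x)=\tau(x^* )$ and $\tau(xy)=\tau(yx)$ for all $x,y\in A$, such that for every $\lambda\in\Lambda$, $S,T\in M(\lambda)$, $b\in B(\lambda)$ and $X=C_{S,T}^b$, $\tau(v^{\mathbf a(X)}X)\equiv 1\bmod v^{-1}\mathcal A^-$ if $S=T$ and $b=1$, and $\equiv0\bmod v^{-1}\mathcal A^-$ otherwise. **Subdatum.** A subdatum of the table datum $(\Lambda,\Gamma,B,M,C,* )$ of $A$ is a tuple $(\Lambda',\Gamma',B',M',C',*')$ such that: (S1) $\Lambda'$ is a subposet of $\Lambda$; (S2) for each $\lambda'\in\Lambda'$, $M'(\lambda')$ is a subset of $M(\lambda')$ and there is a unital monomorphism of based rings $(\Gamma'(\lambda'),B'(\lambda'))\to(\Gamma(\lambda'),B(\lambda'))$ identifying $(\Gamma'(\lambda'),B'(\lambda'))$ with a subhypergroup of $(\Gamma(\lambda'),B(\lambda'))$; (S3) under these identifications, $C'$ and $*'$ are the restrictions of $C$ and $*$ respectively,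 and the $\mathcal A$-span $A'$ of $\operatorname{Im}(C')$ is an $\mathcal A$-subalgebra of $A$. This $A'$ is the subalgebra corresponding to the subdatum. *)

(* Defs.v *)
From HB Require Import structures.
From mathcomp Require Import all_boot all_order all_algebra finmap.
From mathcomp Require Import classical_sets.
From mathcomp.multinomials Require Import monalg.

Set Implicit Arguments.
Unset Strict Implicit.
Unset Printing Implicit Defensive.

Import Order.TTheory GRing.Theory Num.Theory.

Local Open Scope fset_scope.
Local Open Scope ring_scope.

(* [laurent R] is R[v, v^-1]: [p@_n] is the coefficient of v^n in p.  The
   product has to be built here, because the ring structure that monalg puts
   on [{malg R[K]}] asks the exponent monoid K to have no unit but the neutral
   element, which excludes the additive group int. *)
Definition laurent (R : nzRingType) : Type := {malg R[int]}.

HB.instance Definition _ (R : nzRingType) := Choice.on (laurent R).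
HB.instance Definition _ (R : nzRingType) := GRing.Zmodule.on (laurent R).

Section LaurentRing.
Variable R : nzRingType.
Implicit Types (p q r : laurent R) (i j : int) (a b : R).

Definition lmono a i : laurent R := << a *g i >>.

Definition lmul p q : laurent R :=
  \sum_(i <- msupp p) \sum_(j <- msupp q) lmono (p@_i * q@_j) (i + j).

Let lmono0 i : lmono 0 i = 0.
Proof. exact: monalgU0. Qed.

Let lmonoD i a b : lmono (a + b) i = lmono a i + lmono b i.
Proof. exact: monalgUD. Qed.

Let lE p : p = \sum_(i <- msupp p) lmono p@_i i.
Proof. exact: monalgE. Qed.

Let lmulw (d1 d2 : {fset int}) p q : msupp p `<=` d1 -> msupp q `<=` d2 ->
  lmul p q = \sum_(i <- d1) \sum_(j <- d2) lmono (p@_i * q@_j) (i + j).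
Proof.
move=> le1 le2; rewrite /lmul (big_fset_incl _ le1) /=.
  apply/eq_bigr=> i _; apply/big_fset_incl => // k _ /mcoeff_outdom ->.
  by rewrite mulr0 lmono0.
move=> k _ /mcoeff_outdom pk.
by rewrite big1 // => k' _; rewrite pk mul0r lmono0.
Qed.

Let lmul0l : left_zero 0 lmul.
Proof. by move=> p; rewrite /lmul msupp0 big_seq_fset0. Qed.

Let lmul0r : right_zero 0 lmul.
Proof.
by move=> p; rewrite /lmul big1 // => i _; rewrite msupp0 big_seq_fset0.
Qed.

Let lmulDl : left_distributive lmul +%R.
Proof.
move=> p q r; have rr := fsubset_refl (msupp r).
rewrite [in RHS](lmulw (fsubsetUl _ (msupp q)) rr).
rewrite [in RHS](lmulw (fsubsetUr (msupp p) _) rr).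
rewrite (lmulw (msuppD_le _ _) rr) -big_split; apply/eq_bigr=> i _ /=.
rewrite -big_split /=; apply/eq_bigr=> j _.
by rewrite mcoeffD mulrDl lmonoD.
Qed.

Let lmulDr : right_distributive lmul +%R.
Proof.
move=> r p q; have rr := fsubset_refl (msupp r).
rewrite [in RHS](lmulw rr (fsubsetUl _ (msupp q))).
rewrite [in RHS](lmulw rr (fsubsetUr (msupp p) _)).
rewrite (lmulw rr (msuppD_le _ _)) -big_split; apply/eq_bigr=> i _ /=.
rewrite -big_split /=; apply/eq_bigr=> j _.
by rewrite mcoeffD mulrDr lmonoD.
Qed.

Let lmulUU a b i j : lmul (lmono a i) (lmono b j) = lmono (a * b) (i + j).
Proof.
by rewrite (lmulw msuppU_le msuppU_le) !big_seq_fset1 !mcoeffUU.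
Qed.

Let lmul_suml q (I : Type) (s : seq I) (F : I -> laurent R) :
  lmul (\sum_(x <- s) F x) q = \sum_(x <- s) lmul (F x) q.
Proof. exact: (big_morph (lmul^~ q) (fun x y => lmulDl x y q) (lmul0l q)). Qed.

Let lmul_sumr q (I : Type) (s : seq I) (F : I -> laurent R) :
  lmul q (\sum_(x <- s) F x) = \sum_(x <- s) lmul q (F x).
Proof. exact: (big_morph (lmul q) (fun x y => lmulDr q x y) (lmul0r q)). Qed.

Let lmulA : associative lmul.
Proof.
move=> p q r; rewrite (lE p) !lmul_suml; apply/eq_bigr=> i _.
move: (p@_i) => a; rewrite (lE q) lmul_suml !lmul_sumr lmul_suml.
apply/eq_bigr=> j _; move: (q@_j) => b; rewrite (lE r) !lmul_sumr.
by apply/eq_bigr=> k _; rewrite !lmulUU mulrA addrA.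
Qed.

Let lmul1l : left_id (lmono 1 0) lmul.
Proof.
move=> p; rewrite [in LHS](lE p) lmul_sumr [RHS]lE; apply/eq_bigr=> i _.
by rewrite lmulUU mul1r add0r.
Qed.

Let lmul1r : right_id (lmono 1 0) lmul.
Proof.
move=> p; rewrite [in LHS](lE p) lmul_suml [RHS]lE; apply/eq_bigr=> i _.
by rewrite lmulUU mulr1 addr0.
Qed.

Let lone_neq0 : lmono 1 0 != 0.
Proof. by rewrite monalgU_eq0 oner_eq0. Qed.

HB.instance Definition _ := GRing.Zmodule_isNzRing.Build (laurent R)
  lmulA lmul1l lmul1r lmulDl lmulDr lone_neq0.

End LaurentRing.

Section LaurentComRing.
Variable R : comNzRingType.

Let lmulC : commutative (@lmul R).
Proof.
move=> p q; rewrite /lmul exchange_big; apply/eq_bigr=> j _ /=.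
by apply/eq_bigr=> i _; rewrite mulrC addrC.
Qed.

HB.instance Definition _ :=
  GRing.PzRing_hasCommutativeMul.Build (laurent R) lmulC.

End LaurentComRing.

Definition Av : comNzRingType := laurent int.

Definition vpow (n : int) : Av := lmono 1 n.

Definition Avminus : set Av := [set p | forall n : int, 0 < n -> p@_n = 0].

Definition cong_vinv (p q : Av) : Prop :=
  exists2 r, Avminus r & p - q = vpow (-1) * r.

(* The zero polynomial has no degree. *)
Definition has_degree (p : Av) (n : int) : Prop :=
  p@_n <> 0 /\ forall m : int, n < m -> p@_m = 0.

Definition span (R : nzRingType) (V : lmodType R) (X : set V) : set V :=
  [set x | exists2 s : seq (R * V), (forall u, u \in s -> X u.2)
         & x = \sum_(u <- s) u.1 *: u.2].

Definition lincomb (R : nzRingType) (V : lmodType R) (I : choiceType)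
    (e : I -> V) (c : {malg R[I]}) : V :=
  \sum_(i <- msupp c) c@_i *: e i.

Definition is_basis (R : nzRingType) (V : lmodType R) (I : choiceType)
    (e : I -> V) : Prop :=
  forall x, exists! c, x = lincomb e c.

(* The coordinates of x on e: meaningful when e is a basis. *)
Definition coords (R : nzRingType) (V : lmodType R) (I : choiceType)
    (e : I -> V) (x : V) : {malg R[I]} :=
  xget 0 [set c | x = lincomb e c].

(* The basis B is the family [br_elt], indexed without repetition by
   [br_basis]; [zmodule G] is G as a module over int. *)
Record basedRing := BasedRing {
  br_ring :> nzRingType;
  br_basis : choiceType;
  br_elt : br_basis -> br_ring;
  br_basisP : is_basis (br_elt : br_basis -> zmodule br_ring) }.

Definition kappa (G : basedRing) (b : br_basis G) (x : G) : int :=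
  (coords (@br_elt G : _ -> zmodule G) x)@_b.

Definition is_hypergroup (G : basedRing) (bar : G -> G) : Prop :=
  [/\ range (@br_elt G) 1,
      forall i j m : br_basis G, 0 <= kappa m (br_elt i * br_elt j),
      [/\ forall x y, bar (x + y) = bar x + bar y,
          bar 1 = 1,
          forall x y, bar (x * y) = bar y * bar x,
          forall x, bar (bar x) = x
        & (bar @` range (@br_elt G) = range (@br_elt G))%classic]
    & forall i j m : br_basis G,
        kappa m (br_elt i * br_elt j) = kappa i (br_elt m * bar (br_elt j))].

Definition based_ring_hom (G H : basedRing) (f : {rmorphism G -> H}) : Prop :=
  forall b : br_basis G,
    f (br_elt b) = 0 \/ exists c : br_basis H, f (br_elt b) = br_elt c.

(* X is the distinguished basis of a subhypergroup of G: the Z-span of X is a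
   unital subring stable under the anti-automorphism of G (which is unique:
   the last axiom of [is_hypergroup] with b_m = 1 determines it). *)
Definition is_subhypergroup (G : basedRing) (X : set G) : Prop :=
  [/\ (X `<=` range (@br_elt G))%classic,
      X 1,
      forall x y, X x -> X y -> span (X : set (zmodule G)) (x * y)
    & exists2 bar : G -> G, is_hypergroup bar & (bar @` X = X)%classic].

(* Associative algebras, not assumed to have a unit.  When A is unital, the
   idempotents of [idempotent_system] are finitely many and add up to 1. *)
Record algebra := Algebra {
  alg_mod :> lmodType Av;
  amul : alg_mod -> alg_mod -> alg_mod;
  amulA : associative amul;
  amulDl : left_distributive amul +%R;
  amulDr : right_distributive amul +%R;
  ascalerAl : forall (c : Av) x y, c *: amul x y = amul (c *: x) y;
  ascalerAr : forall (c : Av) x y, c *: amul x y = amul x (c *: y) }.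

Notation "x ** y" := (amul x y) (at level 40, left associativity) : ring_scope.

(* The tuple (Lambda, Gamma, B, M, C, star), before any axiom; B(l) is the basis
   of the based ring [Gamma l]. *)
Record tableTuple (A : algebra) := TableTuple {
  td_disp : Order.disp_t;
  Lambda : finPOrderType td_disp;
  Gamma : Lambda -> basedRing;
  M : Lambda -> finType;
  C : forall l, M l -> br_basis (Gamma l) -> M l -> A;
  star : A -> A }.

Arguments Gamma {A} t l.
Arguments M {A} t l.
Arguments C {A} t l S b T.
Arguments star {A} t x.

Section TableData.
Variables (A : algebra) (D : tableTuple A).

Notation B l := (br_basis (Gamma D l)).

Definition idx : choiceType := {l : Lambda D & (M D l * B l * M D l)%type}.

Definition mkidx (l : Lambda D) (S : M D l) (b : B l) (T : M D l) : idx :=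
  existT _ l (S, b, T).

Definition Cidx (X : idx) : A :=
  let: existT l (s, b, t) := X in C D l s b t.

Definition ImC : set A := range Cidx.

(* C_{S,T}^g for g in Gamma(l). *)
Definition Clin (l : Lambda D) (S : M D l) (g : Gamma D l) (T : M D l) : A :=
  \sum_(b <- msupp (coords (@br_elt (Gamma D l) : _ -> zmodule (Gamma D l)) g))
     C D l S b T *~ kappa b g.

(* C_{S,T}^x for x in Z[v, v^-1] (x) Gamma(l), the tensor product over Z being
   represented by Gamma(l)[v, v^-1]. *)
Definition Clau (l : Lambda D) (S : M D l) (x : laurent (Gamma D l))
    (T : M D l) : A :=
  \sum_(n <- msupp x) vpow n *: Clin S x@_n T.

(* A(< l) *)
Definition Alt (l : Lambda D) : set A :=
  span [set x | exists mu (S : M D mu) (b : B mu) (T : M D mu),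
                  (mu < l)%O /\ x = C D mu S b T].

(* E is the set of the idempotents 1_epsilon; the sum of the submodules
   1_epsilon A 1_epsilon' is the span of their union. *)
Definition idempotent_system (E : set A) : Prop :=
  [/\ (E `<=` ImC)%classic,
      forall e, E e -> e ** e = e,
      forall e f, E e -> E f -> e <> f -> e ** f = 0,
      forall x, span [set y | exists e f a, [/\ E e, E f & y = e ** a ** f]] x
    & forall X, ImC X -> exists e f, [/\ E e, E f & X = e ** X ** f]].

Definition axiomA1 (bar : forall l, Gamma D l -> Gamma D l) : Prop :=
  [/\ forall l, is_hypergroup (@bar l),
      injective Cidx,
      is_basis Cidx
    & exists E, idempotent_system E].

Definition axiomA2 (bar : forall l, Gamma D l -> Gamma D l) : Prop :=
  [/\ forall (c : Av) x y, star D (c *: x + y) = c *: star D x + star D y,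
      forall x, star D (star D x) = x,
      forall x y, star D (x ** y) = star D y ** star D x
    & forall l (S T : M D l) (b : B l),
        star D (C D l S b T) = Clin T (bar l (br_elt b)) S].

Definition axiomA3 : Prop :=
  forall (l : Lambda D) (a : A),
  exists r : M D l -> M D l -> laurent (Gamma D l),
  forall (g : Gamma D l) (S T : M D l),
    Alt l (a ** Clin S g T - \sum_(S' : M D l) Clau S' (r S' S * lmono g 0) T).

Definition is_table_datum : Prop :=
  exists bar : forall l, Gamma D l -> Gamma D l,
    [/\ axiomA1 bar, axiomA2 bar & axiomA3].

Definition gcoef (X Y Z : idx) : Av := (coords Cidx (Cidx X ** Cidx Y))@_Z.

(* [a] is the function Z |-> max_{X, Y} deg g_{X,Y,Z}. *)
Definition is_a_function (a : idx -> int) : Prop :=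
  forall Z, (exists X Y, has_degree (gcoef X Y Z) (a Z)) /\
            (forall X Y n, has_degree (gcoef X Y Z) n -> n <= a Z).

Definition gamma (a : idx -> int) (X Y Z : idx) : int := (gcoef X Y Z)@_(a Z).

Definition A4_shape (K K' K'' : idx) : Prop :=
  exists l (S T V : M D l) (b b' b'' : B l),
    [/\ K = mkidx S b T, K' = mkidx T b' V, K'' = mkidx S b'' V
      & kappa b'' (br_elt b * br_elt b') <> 0].

Definition axiomA4 (a : idx -> int) : Prop :=
  (forall K K' K'',
     has_degree (gcoef K K' K'') (a K'') <-> A4_shape K K' K'') /\
  (forall l (S T V : M D l) (b b' b'' : B l),
     br_elt b = 1 -> br_elt b' = 1 -> br_elt b'' = 1 ->
     gamma a (mkidx S b T) (mkidx T b' V) (mkidx S b'' V) = 1).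

Definition axiomA5 (a : idx -> int) : Prop :=
  exists tau : {scalar A},
    [/\ forall x, tau x = tau (star D x),
        forall x y, tau (x ** y) = tau (y ** x)
      & forall l (S T : M D l) (b : B l), let X := mkidx S b T in
          (S = T /\ br_elt b = 1 -> cong_vinv (tau (vpow (a X) *: Cidx X)) 1) /\
          (~ (S = T /\ br_elt b = 1) ->
             cong_vinv (tau (vpow (a X) *: Cidx X)) 0)].

Definition is_table_datum_with_trace : Prop :=
  is_table_datum /\
  exists a : idx -> int, [/\ is_a_function a, axiomA4 a & axiomA5 a].

End TableData.

(* Inclusions are injective maps: [iota] embeds A' into A, [j] embeds Lambda'
   into Lambda with the induced order, [inM] embeds each M'(l) into M(l) and
   [phi] each Gamma'(l) into Gamma(l). *)
Definition is_subdatum (A A' : algebra) (D : tableTuple A) (D' : tableTuple A')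
    (iota : {linear A' -> A}) : Prop :=
  exists (j : Lambda D' -> Lambda D)
         (inM : forall l, M D' l -> M D (j l))
         (phi : forall l, {rmorphism Gamma D' l -> Gamma D (j l)}),
  [/\ forall l m, (j l <= j m)%O = (l <= m)%O,
      forall l, injective (inM l) /\
        [/\ injective (phi l), based_ring_hom (phi l)
          & is_subhypergroup
              [set x | exists b, x = phi l (@br_elt (Gamma D' l) b)]]
    & [/\ forall l (S T : M D' l) (b : br_basis (Gamma D' l)),
             iota (C D' l S b T)
               = Clin (inM l S) (phi l (br_elt b)) (inM l T),
          forall x, iota (star D' x) = star D (iota x),
          injective iota,
          forall x y, iota (x ** y) = iota x ** iota y
        & range iota = span (iota @` ImC D')%classic]].

(* Main.v *)
Require Import Defs.
From HB Require Import structures.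
From mathcomp Require Import all_boot all_order all_algebra finmap.
From mathcomp Require Import boolp classical_sets.
From mathcomp.multinomials Require Import monalg.

Set Implicit Arguments.
Unset Strict Implicit.
Unset Printing Implicit Defensive.

Import Order.TTheory GRing.Theory Num.Theory.

Local Open Scope ring_scope.
Local Open Scope classical_set_scope.

(** Every axiom of a table datum can be read off coordinates on the basis
    Im(C), and passing to a subdatum only selects some of the coordinates.
    Indeed iota sends the family C' to distinct members of the basis C
    ([iota_Cidx], [idx_map_inj]), so C' is a basis of A', the coordinates of
    iota x on the selected members are those of x on C' ([coords_iota]), and
    the other coordinates of iota x vanish ([coords_iota_out]).  The inclusions
    of the based rings Gamma'(l) into Gamma(l) have the same property.

    For [axiomA1], an idempotent 1_e lies in A' and is a member of the basis of
    A; since its only nonzero coordinate must be a selected one, it belongs to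
    C'.  The decomposition X = 1_e X 1_f then takes place inside A'.  The
    anti-automorphism of Gamma'(l) is the restriction of that of Gamma(l): the
    one which comes with the subhypergroup is the same, because the
    anti-automorphism of a hypergroup is determined by the structure constants
    ([hypergroup_bar_unique]).  [axiomA2] is inherited through the injective
    map iota.

    The main point is [axiomA3]: the matrix r_a must be shown to restrict.  Let
    a be in A' and S in M'(l).  The coefficients of r_a(S', S) are the
    coordinates, modulo A(< l), of a C_{S,S}^1, which is in A'.  So they vanish
    outside the selected indices: r_a(S', S) is 0 unless S' is in M'(l), and
    then it comes from Z[v, v^-1] (x) Gamma'(l).  The congruence obtained in
    this way holds modulo A(< l), and an element of A' in A(< l) is in A'(< l),
    again by looking at its coordinates ([Alt_iota]).

    For the trace, the structure constants of A' are those of A at selected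
    indices ([gcoef_idx_map]), so the function a of A' is bounded by the
    restriction of that of A.  The two are equal because, by [axiomA4], the
    maximal degree at C_{S,V}^b is reached at the product of C_{S,S}^1 and
    C_{S,V}^b, both of which are in A'.  Then [axiomA4] and [axiomA5] restrict, with the
    trace tau \o iota. *)

(** * Sums and coordinates *)

Lemma sum_delta (V : zmodType) (I : choiceType) (d : {fset I}) (F : I -> V) k :
  (k \notin d -> F k = 0) -> \sum_(i <- d) F i *+ (i == k) = F k.
Proof.
move=> F0; have [kd|/F0 Fk] := boolP (k \in d).
  rewrite (bigD1_seq k) ?fset_uniq //= eqxx big1 ?addr0 // => i /negPf ->.
  by rewrite mulr0n.
by rewrite Fk big1 // => i _; case: eqP => [->|//]; rewrite Fk.
Qed.

Lemma sum_injective_image (V : nmodType) (I I' : finType) (k : I' -> I)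
    (F : I -> V) :
  injective k -> (forall i, (forall i', i <> k i') -> F i = 0) ->
  \sum_(i : I) F i = \sum_(i' : I') F (k i').
Proof.
move=> k_inj F0; rewrite (bigID [in k @: I']) /= [X in _ + X]big1 ?addr0.
  by rewrite big_imset //= => x y _ _ /k_inj.
by move=> i /imsetP ki; apply: F0 => i' Ei; apply: ki; exists i'.
Qed.

Section Coordinates.
Variables (R : nzRingType) (V : lmodType R) (I : choiceType) (e : I -> V).
Implicit Types (x y : V) (c : {malg R[I]}).

Lemma lincombEw (d : {fset I}) c :
  (msupp c `<=` d)%fset -> lincomb e c = \sum_(i <- d) c@_i *: e i.
Proof.
by move=> cd; apply: big_fset_incl => // i _ /mcoeff_outdom ->; rewrite scale0r.
Qed.

Fact lincomb_is_linear : linear (lincomb e).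
Proof.
move=> a c1 c2; pose d := (msupp c1 `|` msupp c2)%fset.
have d1 : (msupp c1 `<=` d)%fset := fsubsetUl _ _.
have d2 : (msupp c2 `<=` d)%fset := fsubsetUr _ _.
have d3 : (msupp (a *: c1 + c2) `<=` d)%fset.
  by apply: fsubset_trans (msuppD_le _ _) (fsetUSS (msuppZ_le _ _) _).
rewrite (lincombEw d1) (lincombEw d2) (lincombEw d3) scaler_sumr -big_split.
by apply: eq_bigr => i _; rewrite mcoeffD mcoeffZ scalerDl scalerA.
Qed.

HB.instance Definition _ :=
  GRing.isLinear.Build R {malg R[I]} V *:%R (lincomb e) lincomb_is_linear.

Lemma lincombU a i : lincomb e << a *g i >> = a *: e i.
Proof. by rewrite (lincombEw msuppU_le) big_seq_fset1 mcoeffUU. Qed.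

Lemma span_lincomb (X : set V) x :
  (X `<=` range e)%classic -> Defs.span X x -> exists c, x = lincomb e c.
Proof.
move=> Xe [s sX ->]; elim: s sX => [|u s IHs] sX.
  by exists 0; rewrite big_nil linear0.
have [t us|c Ec] := IHs; first by apply: sX; rewrite inE us orbT.
have /Xe[i _ Ei] := sX u (mem_head _ _).
by exists (<< u.1 *g i >> + c); rewrite big_cons Ec linearD /= lincombU Ei.
Qed.

Lemma lincomb_span (X : set V) c :
  (forall i, c@_i != 0 -> X (e i)) -> Defs.span X (lincomb e c).
Proof.
move=> cX; exists [seq (c@_i, e i) | i <- msupp c]; last by rewrite big_map.
by move=> u /mapP[i ic ->] /=; apply: cX; rewrite mcoeff_neq0.
Qed.

Hypothesis be : is_basis e.

Lemma coordsK x : lincomb e (coords e x) = x.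
Proof.
have [c [Ec _]] := be x.
exact/esym/(xgetI (P := [set c | x = lincomb e c]) 0 Ec).
Qed.

Lemma lincombK c : coords e (lincomb e c) = c.
Proof.
have [d [_ Ud]] := be (lincomb e c).
by rewrite -[RHS](Ud c erefl); apply/esym/Ud; rewrite coordsK.
Qed.

Lemma coords_is_linear : linear (coords e).
Proof.
by move=> a x y; rewrite -{1}(coordsK x) -{1}(coordsK y) -linearP lincombK.
Qed.

Definition coords_linear : {linear V -> {malg R[I]}} :=
  HB.pack (coords e)
    (GRing.isLinear.Build R V {malg R[I]} *:%R (coords e) coords_is_linear).

Lemma coordsB : {morph coords e : x y / x - y}.
Proof. exact: (linearB coords_linear). Qed.

Lemma coordsZ a x : coords e (a *: x) = a *: coords e x.
Proof. exact: (linearZ_LR coords_linear). Qed.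

Lemma coords_sum (J : Type) (r : seq J) (P : pred J) (F : J -> V) :
  coords e (\sum_(j <- r | P j) F j) = \sum_(j <- r | P j) coords e (F j).
Proof. exact: (linear_sum coords_linear). Qed.

Lemma coordsU i : coords e (e i) = << 1 *g i >>.
Proof. by rewrite -{1}[e i]scale1r -lincombU lincombK. Qed.

Lemma coords_inj x y : (forall i, (coords e x)@_i = (coords e y)@_i) -> x = y.
Proof. by move=> /malgP Exy; rewrite -[x]coordsK Exy coordsK. Qed.

Lemma coords_span0 (X : set V) x i :
  (forall y, X y -> (coords e y)@_i = 0) -> Defs.span X x ->
  (coords e x)@_i = 0.
Proof.
move=> X0 [s sX ->]; rewrite coords_sum raddf_sum big1_seq //= => u /sX /X0 u0.
by rewrite coordsZ mcoeffZ u0 mulr0.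
Qed.

Lemma basis_inj : injective e.
Proof.
move=> i j /(congr1 (coords e)); rewrite !coordsU => /(congr1 (mcoeff j)).
rewrite mcoeffUU mcoeffU; case: eqP => // _ /eqP.
by rewrite eq_sym oner_eq0.
Qed.

End Coordinates.

(** * Maps that send a basis injectively into a basis *)

Section Embedding.
Variables (R : nzRingType) (V V' : lmodType R) (I I' : choiceType).
Variables (e : I -> V) (e' : I' -> V') (f : {linear V' -> V}) (h : I' -> I).
Hypotheses (be : is_basis e) (fe : forall i, f (e' i) = e (h i)).
Hypothesis h_inj : injective h.

Lemma map_lincomb c : f (lincomb e' c) = \sum_(i <- msupp c) c@_i *: e (h i).
Proof. by rewrite linear_sum; apply: eq_bigr => i _; rewrite linearZ_LR fe. Qed.

Lemma coords_map_lincomb c k :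
  (coords e (f (lincomb e' c)))@_k = \sum_(i <- msupp c) c@_i *+ (h i == k).
Proof.
rewrite map_lincomb (coords_sum be) raddf_sum; apply: eq_bigr => i _ /=.
by rewrite (coordsZ be) (coordsU be) mcoeffZ mcoeffU mulrnAr mulr1.
Qed.

Lemma coords_map_lincomb_in c i : (coords e (f (lincomb e' c)))@_(h i) = c@_i.
Proof.
rewrite coords_map_lincomb -[RHS](sum_delta (d := msupp c)).
  by apply: eq_bigr => j _; rewrite (inj_eq h_inj).
exact: mcoeff_outdom.
Qed.

(** Uniqueness of the coordinates on e' comes from e, since the coordinate of
    f x at h i recovers the one of x at i. *)
Lemma embedded_basis :
  injective f -> (forall x, exists c, x = lincomb e' c) -> is_basis e'.
Proof.
move=> f_inj e'P x; have [c Ec] := e'P x; exists c; split=> // d Ed.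
by apply/malgP => i; rewrite -!coords_map_lincomb_in -Ec -Ed.
Qed.

Hypothesis be' : is_basis e'.

Lemma coords_map x i : (coords e (f x))@_(h i) = (coords e' x)@_i.
Proof. by rewrite -{1}(coordsK be' x) coords_map_lincomb_in. Qed.

Lemma coords_map_out x k : (coords e (f x))@_k != 0 -> exists i, k = h i.
Proof.
rewrite -(coordsK be' x) coords_map_lincomb => /eqP nz.
apply: contrapT => nk; apply: nz; rewrite big1 // => i _.
by case: eqP => [hk|//]; case: nk; exists i.
Qed.

Lemma map_preimage y :
  (forall k, (coords e y)@_k != 0 -> exists i, k = h i) -> exists x, f x = y.
Proof.
move=> yh; pose d := coords e y.
(* Outside the image of h, g is arbitrary: the coefficient of y is 0 there. *)
have [g gK] : {g : I -> V' & forall k, d@_k *: f (g k) = d@_k *: e k}.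
  apply: (@choice I V' (fun k v => d@_k *: f v = d@_k *: e k)) => k.
  have [->|/yh[i ->]] := eqVneq d@_k 0; first by exists 0; rewrite !scale0r.
  by exists (e' i); rewrite fe.
exists (\sum_(k <- msupp d) d@_k *: g k).
rewrite linear_sum -[RHS](coordsK be y).
by apply: eq_bigr => k _; rewrite linearZ_LR gK.
Qed.

End Embedding.

(** * Laurent polynomials *)

Lemma mcoeff_mulr_const (R : nzRingType) (p : laurent R) (g : R) n :
  (p * lmono g 0)@_n = p@_n * g.
Proof.
have -> : p * lmono g 0 = \sum_(i <- msupp p) lmono (p@_i * g) i.
  apply: eq_bigr => i _.
  rewrite (big_fset_incl _ (msuppU_le (k := 0) (x := g))) /=.
    by rewrite big_seq_fset1 mcoeffUU addr0.
  by move=> k _ /mcoeff_outdom ->; rewrite mulr0; apply: monalgU0.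
rewrite raddf_sum /= -(sum_delta (d := msupp p) (F := fun i => p@_i * g)).
  by apply: eq_bigr => i _; rewrite mcoeffU.
by move=> /mcoeff_outdom ->; rewrite mul0r.
Qed.

Lemma intr_lmono (z : int) : z%:~R = lmono z 0 :> Av.
Proof. by rewrite -[z in RHS]intz [RHS](raddfMz (mkmalgU 0) z 1). Qed.

Lemma mcoeff_vpow_int n m (z : int) : (vpow n * z%:~R)@_m = z *+ (n == m).
Proof. by rewrite intr_lmono mcoeff_mulr_const mcoeffU mulrnAl mul1r. Qed.

(** * Based rings and hypergroups *)

Section BasedRing.
Variable G : basedRing.
Implicit Types (b c : br_basis G) (x y : G).

Let bG := @br_basisP G.

Lemma kappa_elt b c : kappa b (br_elt c) = (c == b)%:R.
Proof. by rewrite /kappa (coordsU bG) mcoeffU. Qed.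

Lemma kappa_inj x y : (forall b, kappa b x = kappa b y) -> x = y.
Proof. exact: (coords_inj bG). Qed.

Lemma br_elt_inj : injective (@br_elt G).
Proof. exact: (basis_inj bG). Qed.

Lemma kappa0 b : kappa b (0 : G) = 0.
Proof. by rewrite /kappa -(subrr 0) (coordsB bG) subrr mcoeff0. Qed.

Lemma kappaB b : {morph kappa b : x y / x - y}.
Proof. by move=> x y; rewrite /kappa (coordsB bG) mcoeffB. Qed.

Lemma kappa_expand x :
  x = \sum_(b <- msupp (coords (@br_elt G : _ -> zmodule G) x))
        br_elt b *~ kappa b x.
Proof. by rewrite -{1}(coordsK bG x). Qed.

(** By the last axiom of a hypergroup with m the index of 1, the coefficient
    of c in bar b is the coefficient of 1 in c b, which does not involve the
    anti-automorphism. *)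
Lemma hypergroup_bar_unique (bar1 bar2 : G -> G) b :
  is_hypergroup bar1 -> is_hypergroup bar2 ->
  bar1 (br_elt b) = bar2 (br_elt b).
Proof.
move=> [[u _ u1] _ _ h1] [_ _ _ h2]; apply: kappa_inj => c.
by have := h1 c b u; rewrite h2 u1 !mul1r.
Qed.

End BasedRing.

Section ZmoduleMorphism.
Variables (G H : nzRingType) (f : {rmorphism G -> H}).

(** A ring morphism seen as an int-linear map, so that the results on bases of
    modules apply to based rings. *)
Definition zmodule_map (x : zmodule G) : zmodule H := f x.

Fact zmodule_map_is_linear : linear zmodule_map.
Proof. by move=> a x y; rewrite /zmodule_map rmorphD raddfMz. Qed.

HB.instance Definition _ := GRing.isLinear.Build int (zmodule G) (zmodule H)
  *:%R zmodule_map zmodule_map_is_linear.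

End ZmoduleMorphism.

Section SubBasedRing.
Variables (G H : basedRing) (f : {rmorphism G -> H}).
Variable (h : br_basis G -> br_basis H).
Hypotheses (f_inj : injective f) (fh : forall b, f (br_elt b) = br_elt (h b)).

Lemma index_map_inj : injective h.
Proof.
by move=> b c bc; apply/br_elt_inj/f_inj; rewrite !fh bc.
Qed.

Lemma kappa_map b x : kappa (h b) (f x) = kappa b x.
Proof.
exact: (coords_map (f := zmodule_map f) (@br_basisP H) fh index_map_inj
         (@br_basisP G)).
Qed.

Lemma map_kappa_preimage y :
  (forall c, kappa c y != 0 -> exists b, c = h b) -> exists x, f x = y.
Proof.
exact: (map_preimage (f := zmodule_map f) (@br_basisP H) fh).
Qed.

(** An anti-automorphism that permutes the selected basis elements preserves
    their span, which is the image of f, and hence lifts to G. *)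
Lemma sub_hypergroup (bar : H -> H) :
  is_hypergroup bar ->
  range (@br_elt H \o h) 1 ->
  (bar @` range (@br_elt H \o h) = range (@br_elt H \o h))%classic ->
  exists2 bar' : G -> G, is_hypergroup bar'
    & forall x, f (bar' x) = bar (f x).
Proof.
move=> [_ h2 [barD bar1 barM barK barB] h4] [u _ hu] barX.
have barh b : exists c, bar (f (br_elt b)) = f (br_elt c).
  have : (bar @` range (@br_elt H \o h))%classic (bar (br_elt (h b))).
    by exists (br_elt (h b)) => //; exists b.
  by rewrite barX => -[c _ Ec]; exists c; rewrite !fh -Ec.
have bar0 : bar 0 = 0 by apply: (addrI (bar 0)); rewrite -barD !addr0.
pose baradd : {additive H -> H} := HB.pack bar
  (GRing.isNmodMorphism.Build H H bar (conj bar0 barD)).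
have barf x : exists y, f y = bar (f x).
  have [k kK] := choice barh.
  exists (\sum_(b <- msupp (coords (@br_elt G : _ -> zmodule G) x))
            br_elt (k b) *~ kappa b x).
  rewrite -[RHS]/(baradd (f x)) [in RHS](kappa_expand x) !raddf_sum.
  by apply: eq_bigr => b _; rewrite !raddfMz; congr (_ *~ _); apply/esym/kK.
have [bar' bar'E] := choice barf.
exists bar' => //; split.
- by exists u => //; apply: f_inj; rewrite rmorph1 fh.
- by move=> i k m; rewrite -kappa_map rmorphM !fh.
- split.
  + by move=> x y; apply: f_inj; rewrite rmorphD !bar'E rmorphD barD.
  + by apply: f_inj; rewrite bar'E rmorph1.
  + by move=> x y; apply: f_inj; rewrite rmorphM !bar'E rmorphM barM.
  + by move=> x; apply: f_inj; rewrite !bar'E barK.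
  + have sub b : exists c, bar' (br_elt b) = br_elt c.
      have [c Ec] := barh b; exists c; apply: f_inj.
      by rewrite bar'E Ec.
    rewrite eqEsubset; split=> [_ [_ [b _ <-] <-]|_ [b _ <-]].
      by have [c ->] := sub b; exists c.
    have [c Ec] := sub b; exists (br_elt c); first by exists c.
    by rewrite -Ec; apply: f_inj; rewrite !bar'E barK.
- move=> i k m; rewrite -kappa_map rmorphM !fh h4 -(kappa_map i).
  by rewrite rmorphM bar'E !fh.
Qed.

End SubBasedRing.

(** * Coordinates on the basis of a table datum *)

Section TableCoordinates.
Variables (A : algebra) (D : tableTuple A).
Hypothesis bD : is_basis (@Cidx A D).

Lemma mkidx_eq l (S S' T T' : M D l) (b b' : br_basis (Gamma D l)) :
  mkidx S b T = mkidx S' b' T' -> [/\ S = S', b = b' & T = T'].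
Proof. by move=> E; have [-> -> ->] := eq_from_Tagged E. Qed.

Lemma coords_Clin l (S T : M D l) (g : Gamma D l) Z :
  (coords (@Cidx A D) (Clin S g T))@_Z =
  \sum_(b <- msupp (coords (@br_elt (Gamma D l) : _ -> zmodule (Gamma D l)) g))
     (kappa b g)%:~R *+ (mkidx S b T == Z).
Proof.
rewrite (coords_sum bD) raddf_sum; apply: eq_bigr => b _ /=.
rewrite -scaler_int -[C _ _ _ _ _]/(Cidx (mkidx S b T)).
by rewrite (coordsZ bD) (coordsU bD) mcoeffZ mcoeffU mulrnAr mulr1.
Qed.

Lemma coords_Clin_in l (S T : M D l) (g : Gamma D l) b :
  (coords (@Cidx A D) (Clin S g T))@_(mkidx S b T) = (kappa b g)%:~R.
Proof.
rewrite coords_Clin -[RHS](sum_delta (F := fun b => (kappa b g)%:~R)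
  (d := msupp (coords (@br_elt (Gamma D l) : _ -> zmodule (Gamma D l)) g))).
  apply: eq_bigr => c _; congr (_ *+ nat_of_bool _).
  by apply/eqP/eqP => [/mkidx_eq[]//|->].
by move=> /mcoeff_outdom Ek; rewrite /kappa Ek.
Qed.

Lemma coords_Clin_out l (S T : M D l) (g : Gamma D l) Z :
  (forall b, Z <> mkidx S b T) -> (coords (@Cidx A D) (Clin S g T))@_Z = 0.
Proof.
move=> Z_out; rewrite coords_Clin big1 // => b _.
by case: eqP => // /esym /Z_out.
Qed.

Lemma Clin_elt l (S T : M D l) (b : br_basis (Gamma D l)) :
  Clin S (br_elt b) T = C D l S b T.
Proof.
rewrite -[RHS]/(Cidx (mkidx S b T)); apply: (coords_inj bD) => Z.
rewrite (coordsU bD) mcoeffU.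
have [[c ->]|nZ] := EM (exists c, Z = mkidx S c T).
  rewrite coords_Clin_in kappa_elt natz -pmulrn; congr (_%:R).
  congr nat_of_bool.
  by apply/eqP/eqP => [->//|/mkidx_eq[]].
rewrite coords_Clin_out; last by move=> c Ec; apply: nZ; exists c.
by case: eqP => // Ec; case: nZ; exists b.
Qed.

Lemma ClinB l (S T : M D l) :
  {morph (fun g : Gamma D l => Clin S g T) : x y / x - y}.
Proof.
move=> x y; apply: (coords_inj bD) => Z; rewrite (coordsB bD) mcoeffB.
have [[c ->]|nZ] := EM (exists c, Z = mkidx S c T).
  by rewrite !coords_Clin_in kappaB rmorphB.
have Z_out b : Z <> mkidx S b T by move=> Ec; apply: nZ; exists b.
by rewrite !coords_Clin_out // subr0.
Qed.

Definition Clin_additive l (S T : M D l) : {additive Gamma D l -> A} :=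
  HB.pack (fun g : Gamma D l => Clin S g T)
    (GRing.isZmodMorphism.Build (Gamma D l) A _ (@ClinB l S T)).

Lemma coords_Clau_in l (S T : M D l) (x : laurent (Gamma D l)) b n :
  (coords (@Cidx A D) (Clau S x T))@_(mkidx S b T)@_n = kappa b x@_n.
Proof.
rewrite (coords_sum bD) raddf_sum /= raddf_sum /=.
rewrite -[RHS](sum_delta (d := msupp x) (F := fun m => kappa b x@_m)).
  apply: eq_bigr => m _.
  by rewrite (coordsZ bD) mcoeffZ coords_Clin_in mcoeff_vpow_int.
by move=> /mcoeff_outdom ->; rewrite kappa0.
Qed.

Lemma coords_Clau_out l (S T : M D l) (x : laurent (Gamma D l)) Z :
  (forall b, Z <> mkidx S b T) -> (coords (@Cidx A D) (Clau S x T))@_Z = 0.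
Proof.
move=> Z_out; rewrite (coords_sum bD) raddf_sum /= big1 // => m _.
by rewrite (coordsZ bD) mcoeffZ coords_Clin_out // mulr0.
Qed.

(** Because A(< l) is spanned by members of the basis, it is detected on
    coordinates; [Alt_coords] is the converse. *)
Lemma coords_Alt l y Z :
  Alt l y -> (coords (@Cidx A D) y)@_Z != 0 -> (tag Z < l)%O.
Proof.
move=> yl; apply: contraNT => Zl; apply/eqP.
apply: (coords_span0 bD) yl => _ [mu [S [b [T [mul ->]]]]].
rewrite -[C _ _ _ _ _]/(Cidx (mkidx S b T)) (coordsU bD) mcoeffU.
by case: eqP => // Ez; rewrite -Ez mul in Zl.
Qed.

Lemma Alt_coords l y :
  (forall Z, (coords (@Cidx A D) y)@_Z != 0 -> (tag Z < l)%O) -> Alt l y.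
Proof.
move=> yl; rewrite -(coordsK bD y); apply: lincomb_span.
by move=> [mu [[S b] T]] /yl mul; exists mu, S, b, T.
Qed.

End TableCoordinates.

(** * Restriction of the axioms to a subdatum *)

Section Subdatum.
Variables (A A' : algebra) (D : tableTuple A) (D' : tableTuple A').
Variable iota : {linear A' -> A}.
Variables (j : Lambda D' -> Lambda D).
Variable inM : forall l, M D' l -> M D (j l).
Variable phi : forall l, {rmorphism Gamma D' l -> Gamma D (j l)}.
Variable h : forall l, br_basis (Gamma D' l) -> br_basis (Gamma D (j l)).
Hypothesis bD : is_basis (@Cidx A D).
Hypothesis j_mono : forall l m, (j l <= j m)%O = (l <= m)%O.
Hypothesis inM_inj : forall l, injective (@inM l).
Hypothesis phi_inj : forall l, injective (phi l).
Hypothesis phi_elt : forall l b, phi l (br_elt b) = br_elt (h b).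
Hypothesis iotaC : forall l (S T : M D' l) (b : br_basis (Gamma D' l)),
  iota (C D' l S b T) = Clin (inM S) (phi l (br_elt b)) (inM T).
Hypothesis iota_star : forall x, iota (star D' x) = star D (iota x).
Hypothesis iota_inj : injective iota.
Hypothesis iotaM : forall x y, iota (x ** y) = iota x ** iota y.
Hypothesis iota_range : range iota = Defs.span (iota @` ImC D')%classic.

Let j_inj : injective j.
Proof. by move=> l m jlm; apply/le_anti; rewrite -!j_mono jlm lexx. Qed.

Let h_inj l : injective (@h l).
Proof. exact: (index_map_inj (@phi_inj l) (@phi_elt l)). Qed.

Definition idx_map (X : idx D') : idx D :=
  let: existT l (s, b, t) := X in mkidx (inM s) (h b) (inM t).

Lemma idx_map_preimage l (S T : M D (j l)) (c : br_basis (Gamma D (j l))) X :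
  mkidx S c T = idx_map X ->
  exists S0 b T0, [/\ S = inM S0, c = h b, T = inM T0 & X = mkidx S0 b T0].
Proof.
case: X => m [[s b] t] E; have := congr1 (@tag _ _) E => /= /j_inj lm.
by subst m; have [-> -> ->] := mkidx_eq E; exists s, b, t.
Qed.

Lemma idx_map_inj : injective idx_map.
Proof.
case=> l [[s b] t] Y E; have [S0 [b0 [T0 [sE bE tE ->]]]] := idx_map_preimage E.
by rewrite (inM_inj sE) (h_inj bE) (inM_inj tE).
Qed.

Lemma iota_Cidx X : iota (Cidx X) = Cidx (idx_map X).
Proof. by case: X => l [[s b] t]; rewrite /= iotaC phi_elt Clin_elt. Qed.

Lemma subdatum_basis : is_basis (@Cidx A' D').
Proof.
apply: (embedded_basis bD iota_Cidx idx_map_inj iota_inj) => x.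
have : range iota (iota x) by exists x.
rewrite iota_range => /(span_lincomb (e := iota \o @Cidx A' D'))[|c Ec].
  by move=> _ [_ [X _ <-] <-]; exists X.
exists c; apply: iota_inj; rewrite Ec linear_sum.
by apply: eq_bigr => X _; rewrite linearZ_LR.
Qed.

Let bD' := subdatum_basis.

Lemma coords_iota x X :
  (coords (@Cidx A D) (iota x))@_(idx_map X) = (coords (@Cidx A' D') x)@_X.
Proof. exact: (coords_map bD iota_Cidx idx_map_inj bD'). Qed.

Lemma coords_iota_out x Z :
  (coords (@Cidx A D) (iota x))@_Z != 0 -> exists X, Z = idx_map X.
Proof. exact: (coords_map_out bD iota_Cidx bD'). Qed.

(** A(< j l) meets A' inside A'(< l): the indices in the support of y map below
    j l, hence are below l since j reflects the order. *)
Lemma Alt_iota l y : Alt (j l) (iota y) -> Alt l y.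
Proof.
move=> yl; apply: (Alt_coords bD') => Z; rewrite -coords_iota.
move/(coords_Alt bD yl); case: Z => m [[s b] t] /=.
by rewrite !lt_def j_mono (inj_eq j_inj).
Qed.

Lemma sub_idempotent_system E :
  idempotent_system D E -> (E `<=` range iota)%classic ->
  idempotent_system D' (iota @^-1` E)%classic.
Proof.
move=> [EC Eid Eorth _ Edec] Eio.
(* The two idempotents that decompose iota X in A lie in the range of iota, so
   the decomposition can be pulled back. *)
have dec X : ImC D' X -> exists e f,
    [/\ E (iota e), E (iota f) & X = e ** X ** f].
  move=> [Z _ <-]; have [|e [f [Ee Ef]]] := Edec (iota (Cidx Z)).
    by rewrite iota_Cidx; exists (idx_map Z).
  have [e' _ ee] := Eio e Ee; have [f' _ ff] := Eio f Ef.
  move: Ee Ef; rewrite -ee -ff -!iotaM => Ee Ef /iota_inj; by exists e', f'.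
split=> //.
- (* The only nonzero coordinate of iota e is at Z, so Z is selected. *)
  move=> e /EC[Z _ ez]; have [X EX] : exists X, Z = idx_map X.
    by apply: (@coords_iota_out e); rewrite -ez (coordsU bD) mcoeffUU oner_eq0.
  by exists X => //; apply: iota_inj; rewrite iota_Cidx -EX.
- by move=> e Ee; apply: iota_inj; rewrite iotaM Eid.
- move=> e f Ee Ef ef; apply: iota_inj; rewrite iotaM linear0 Eorth //.
  by move/iota_inj.
- move=> x; rewrite -(coordsK bD' x); apply: lincomb_span => X _.
  have [|e [f [Ee Ef EX]]] := dec (Cidx X); first by exists X.
  by exists e, f, (Cidx X).
Qed.

Lemma iota_Clin l (S T : M D' l) (g : Gamma D' l) :
  iota (Clin S g T) = Clin (inM S) (phi l g) (inM T).
Proof.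
rewrite -[RHS]/(Clin_additive bD (inM S) (inM T) (phi l g)).
rewrite [in RHS](kappa_expand g) !raddf_sum; apply: eq_bigr => b _.
by rewrite !raddfMz; congr (_ *~ _); apply: iotaC.
Qed.

Lemma iota_Clau l (S T : M D' l) (x' : laurent (Gamma D' l)) x :
  (forall n, phi l x'@_n = x@_n) ->
  iota (Clau S x' T) = Clau (inM S) x (inM T).
Proof.
move=> xE; have Ex : msupp x' = msupp x.
  apply/fsetP => n; rewrite -!mcoeff_neq0 -xE.
  by rewrite -(inj_eq (@phi_inj l)) rmorph0.
rewrite linear_sum /Clau -Ex; apply: eq_bigr => n _.
by rewrite linearZ_LR iota_Clin xE.
Qed.

(** The coefficients can be pulled back one at a time, as phi l is injective and
    its image is the span of the selected basis elements. *)
Lemma laurent_preimage l (x : laurent (Gamma D (j l))) :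
  (forall n c, kappa c x@_n != 0 -> exists b, c = h b) ->
  exists x' : laurent (Gamma D' l), forall n, phi l x'@_n = x@_n.
Proof.
move=> xh; have xP n : exists y, phi l y = x@_n.
  exact: (map_kappa_preimage (@phi_elt l) (xh n)).
have [y yE] := choice xP.
exists (\sum_(n <- msupp x) lmono (y n) n) => m; rewrite -yE raddf_sum /=.
rewrite -[in RHS](sum_delta (d := msupp x) (F := y)).
  by congr (phi l _); apply: eq_bigr => n _; rewrite mcoeffU.
move=> /mcoeff_outdom xm; apply: phi_inj.
by rewrite yE xm rmorph0.
Qed.

Lemma sub_axiomA2 bar bar' :
  axiomA2 (D := D) bar ->
  (forall l x, phi l (bar' l x) = bar (j l) (phi l x)) ->
  axiomA2 (D := D') bar'.
Proof.
move=> [starP starK starM starC] barE; split=> [c x y|x|x y|l S T b].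
- by apply: iota_inj; rewrite iota_star !linearP /= starP !iota_star.
- by apply: iota_inj; rewrite !iota_star starK.
- by apply: iota_inj; rewrite iota_star !iotaM starM !iota_star.
- apply: iota_inj.
  by rewrite iota_star iotaC iota_Clin barE phi_elt Clin_elt // starC.
Qed.

(** The matrix r' is the restriction of r, once it is known that the columns of
    r indexed by M'(l) are supported on M'(l), with entries that come from
    Gamma'(l). *)
Lemma sub_axiomA3 : axiomA3 D -> axiomA3 D'.
Proof.
move=> A3 l a; have [r rP] := A3 (j l) (iota a).
(* The coefficient of c in r(S', S) is the coordinate of a C_{S,S}^1 at
   C_{S',S}^c; taking T = S provides an element of M'(l). *)
have r_in S S' c n : kappa c (r S' (inM S))@_n != 0 ->
    exists S0 b, S' = inM S0 /\ c = h b.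
  move=> nz; pose Z := mkidx S' c (inM S).
  have aZ : (coords (@Cidx A D) (iota (a ** Clin S 1 S)))@_Z@_n
          = kappa c (r S' (inM S))@_n.
    have := rP 1 (inM S) (inM S).
    rewrite -(rmorph1 (phi l)) -iota_Clin -iotaM => w_lt.
    have := contraNeq (coords_Alt bD w_lt (Z := Z)).
    rewrite /= ltxx => /(_ isT)/eqP.
    rewrite (coordsB bD) mcoeffB subr_eq0 => /eqP ->.
    rewrite (coords_sum bD) raddf_sum /= (bigD1 S') //= big1 ?addr0.
      by rewrite (coords_Clau_in bD) mcoeff_mulr_const rmorph1 mulr1.
    move=> S'' neq; apply: (coords_Clau_out bD) => b /mkidx_eq[] E.
    by rewrite E eqxx in neq.
  have [|X EX] := @coords_iota_out (a ** Clin S 1 S) Z.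
    by apply: contra_neq nz => Z0; rewrite -aZ Z0 mcoeff0.
  by have [S0 [b [_ [-> -> _ _]]]] := idx_map_preimage EX; exists S0, b.
have r_lift S0 S : exists x' : laurent (Gamma D' l),
    forall n, phi l x'@_n = (r (inM S0) (inM S))@_n.
  by apply: laurent_preimage => n c /r_in[_ [b [_ ->]]]; exists b.
have [r' r'E] : {r' : M D' l -> M D' l -> laurent (Gamma D' l) & forall S0 S n,
    phi l (r' S0 S)@_n = (r (inM S0) (inM S))@_n}.
  have [r' r'E] := choice (fun p : M D' l * M D' l => r_lift p.1 p.2).
  by exists (fun S0 S => r' (S0, S)) => S0 S; apply: (r'E (S0, S)).
exists r' => g S T; apply: Alt_iota.
rewrite linearB linear_sum /= iotaM iota_Clin.
have := rP (phi l g) (inM S) (inM T).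
rewrite (sum_injective_image (@inM_inj l)).
  congr (Alt _ (_ - _)); apply: eq_bigr => S0 _; apply/esym/iota_Clau => n.
  by rewrite !mcoeff_mulr_const rmorphM r'E.
move=> S' nS'; suff -> : r S' (inM S) = 0.
  by rewrite mul0r /Clau msupp0 big_seq_fset0.
apply/malgP => n; apply: kappa_inj => c; rewrite mcoeff0 kappa0; apply/eqP.
by apply/negPn/negP => /r_in[S0 [b [/nS']]].
Qed.

Lemma gcoef_idx_map X Y Z :
  gcoef (idx_map X) (idx_map Y) (idx_map Z) = gcoef X Y Z.
Proof. by rewrite /gcoef -!iota_Cidx -iotaM coords_iota. Qed.

Lemma kappa_mul_map l (b b' b'' : br_basis (Gamma D' l)) :
  kappa (h b'') (br_elt (h b) * br_elt (h b'))
  = kappa b'' (br_elt b * br_elt b').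
Proof. by rewrite -!phi_elt -rmorphM (kappa_map (@phi_inj l) (@phi_elt l)). Qed.

(** From right to left this uses that j, inM and h are injective: equal indices
    in D come from equal indices in D'. *)
Lemma A4_shape_idx_map K K' K'' :
  A4_shape (idx_map K) (idx_map K') (idx_map K'') <-> A4_shape K K' K''.
Proof.
split; last first.
  move=> [l [S [T [V [b [b' [b'' [-> -> -> nz]]]]]]]].
  exists (j l), (inM S), (inM T), (inM V), (h b), (h b'), (h b'').
  by split=> //; rewrite kappa_mul_map.
case: K => l [[s b] t] [l1 [S [T [V [b1 [b' [b'' [EK EK' EK'' nz]]]]]]]].
have El : j l = l1 := congr1 (@tag _ _) EK.
subst l1; have [Es Eb Et] := mkidx_eq EK; subst S b1 T.
have [t' [c' [v [/inM_inj <- Ec' Ev ->]]]] := idx_map_preimage (esym EK').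
have [s' [c'' [w [/inM_inj <- Ec'' Ew ->]]]] := idx_map_preimage (esym EK'').
subst b' b'' V; exists l, s, t, v, b, c', c''; split=> //.
  by rewrite (inM_inj Ew).
by rewrite -kappa_mul_map.
Qed.

Lemma elt_map_eq1 l (b : br_basis (Gamma D' l)) :
  br_elt (h b) = 1 <-> br_elt b = 1.
Proof.
rewrite -phi_elt -(rmorph1 (phi l)).
by split=> [/phi_inj//|->].
Qed.

Lemma sub_axiomA4 a : axiomA4 (D := D) a -> axiomA4 (D := D') (a \o idx_map).
Proof.
move=> [A4 A4'1]; split=> [K K' K''|l S T V b b' b'' b1 b'1 b''1].
  by rewrite -gcoef_idx_map A4 A4_shape_idx_map.
rewrite -(A4'1 _ (inM S) (inM T) (inM V) (h b) (h b') (h b'')) ?elt_map_eq1 //.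
by rewrite /gamma -gcoef_idx_map.
Qed.

(** The maximum that defines a(Z) is still reached in A': for Z = C_{S,V}^b, it
    is reached at X = C_{S,S}^1 and Y = Z by [axiomA4]. *)
Lemma sub_a_function a :
  (forall l, exists u : br_basis (Gamma D' l), br_elt u = 1) ->
  axiomA4 (D := D) a -> is_a_function (D := D) a ->
  is_a_function (D := D') (a \o idx_map).
Proof.
move=> unitE /sub_axiomA4[A4 _] aP Z; split; last first.
  by move=> X Y n; rewrite -gcoef_idx_map; apply: (aP _).2.
case: Z => l [[S b] V]; have [u u1] := unitE l.
exists (mkidx S u S), (mkidx S b V); apply/A4.
exists l, S, S, V, u, b, b; split=> //.
by rewrite u1 mul1r kappa_elt eqxx.
Qed.

Lemma sub_axiomA5 a : axiomA5 (D := D) a -> axiomA5 (D := D') (a \o idx_map).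
Proof.
move=> [tau [tau_star tauC tauP]]; exists (tau \o iota).
split=> [x|x y|l S T b X] /=.
- by rewrite iota_star -tau_star.
- by rewrite !iotaM tauC.
have [P1 P0] := tauP _ (inM S) (inM T) (h b).
rewrite linearZ_LR iotaC phi_elt Clin_elt //; split=> [[ST b1]|nST].
  by apply: P1; split; [rewrite ST | apply/elt_map_eq1].
by apply: P0 => -[/inM_inj ST /elt_map_eq1 b1]; apply: nST.
Qed.

End Subdatum.

Theorem proposition2p1p5 (A A' : algebra) (D : tableTuple A)
    (D' : tableTuple A') (iota : {linear A' -> A}) (E : set A)
    (tabD : is_table_datum D) (idemE : idempotent_system D E)
    (subD : is_subdatum D D' iota) (subE : E `<=` range iota) :
  is_table_datum D' /\
  (is_table_datum_with_trace D -> is_table_datum_with_trace D').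
Proof.
have [bar [[hyp _ bD _] A2 A3]] := tabD.
have [j [inM [phi [j_mono sub_l data]]]] := subD.
have [iotaC iota_star iota_inj iotaM iota_range] := data.
have inM_inj l := (sub_l l).1.
have phi_inj l : injective (phi l) by have [_ []] := sub_l l.
have subX l := let: And3 _ _ s := (sub_l l).2 in s.
have hP l (b : br_basis (Gamma D' l)) : exists c, phi l (br_elt b) = br_elt c.
  have [Xsub _ _ _] := subX l; have [|c _ Ec] := Xsub (phi l (br_elt b)).
    by exists b.
  by exists c.
pose h l := projT1 (choice (@hP l)).
have phi_elt l b : phi l (br_elt b) = br_elt (h l b) :=
  projT2 (choice (@hP l)) b.
have rangeX l : [set x | exists b, x = phi l (@br_elt (Gamma D' l) b)]
    = range (@br_elt _ \o h l).
  rewrite eqEsubset; split=> [_ [b ->]|_ [b _ <-]].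
    by exists b => //=; rewrite phi_elt.
  by exists b; rewrite /= phi_elt.
(* By uniqueness, the anti-automorphism that preserves the subhypergroup is that
   of D, which is the one compatible with star. *)
have bar'P l : {bar' : Gamma D' l -> Gamma D' l &
    is_hypergroup bar' /\ forall x, phi l (bar' x) = bar (j l) (phi l x)}.
  apply: cid; have := subX l; rewrite rangeX => -[_ X1 _ [bar2 hyp2 bar2X]].
  have barX : (bar (j l) @` range (@br_elt _ \o h l)
               = range (@br_elt _ \o h l))%classic.
    rewrite -[RHS]bar2X; apply: eq_imagel => _ [b _ <-] /=.
    exact: hypergroup_bar_unique (hyp _) hyp2.
  have [bar' bar'H bar'E] :=
    sub_hypergroup (phi_inj l) (phi_elt l) (hyp (j l)) X1 barX.
  by exists bar'.
pose bar' l := projT1 (bar'P l).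
have bar'H l : is_hypergroup (bar' l) := (projT2 (bar'P l)).1.
have bar'E l : forall x, phi l (bar' l x) = bar (j l) (phi l x) :=
  (projT2 (bar'P l)).2.
have tabD' : is_table_datum D'.
  exists bar'; split.
  - have bD' : is_basis (@Cidx A' D').
      exact: (subdatum_basis bD j_mono inM_inj phi_inj phi_elt).
    split=> //; first exact: (basis_inj bD').
    exists (iota @^-1` E).
    exact: (sub_idempotent_system bD j_mono inM_inj phi_inj phi_elt).
  - exact: (sub_axiomA2 bD phi_elt iotaC iota_star iota_inj iotaM A2 bar'E).
  - exact: (sub_axiomA3 bD j_mono inM_inj phi_inj phi_elt).
split=> // -[_ [a [aP A4 A5]]]; split=> //.
exists (a \o idx_map inM h); split.
- apply: (sub_a_function bD j_mono inM_inj phi_inj phi_elt) => // l.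
  by have [[u _ u1] _ _ _] := bar'H l; exists u.
- exact: (sub_axiomA4 bD j_mono inM_inj phi_inj phi_elt).
- exact: (sub_axiomA5 bD).
Qed.
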